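(* Let $X$ and $Y$ be topological spaces, or just closure spaces, and let $\varphi : X \to Y$ be a function. Let $\varphi^{\rightarrow} : \mathcal P(X) \to \mathcal P(Y)$ be the image function, $\varphi^{\rightarrow}(a) = \{\varphi(x) \mid x \in a\}$. Then the following conditions are equivalent. (1) $\varphi$ is continuous from $X$ to $Y$; (2) $\varphi^{\rightarrow}$ is a homomorphism of specialization semilattices from $\mathbf S(X)$ to $\mathbf S(Y)$; (3) $\varphi^{\rightarrow}$ is a homomorphism of specialization posets from $\mathbf P(X)$ to $\mathbf P(Y)$. Moreover, the following conditions are also equivalent. (1') $\varphi$ is an embedding of $X$ into $Y$; (2') $\varphi^{\rightarrow}$ is an embedding of specialization semilattices from $\mathbf S(X)$ to $\mathbf S(Y)$; (3') $\varphi^{\rightarrow}$ is an embedding of specialization posets from $\mathbf P(X)$ to $\mathbf P(Y)$.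
   Context: A closure space is a set $X$ with a family of subsets of $X$ (called closed) that contains $X$ and is closed under arbitrary intersections (no assumption is made on finite unions or on $\emptyset$). Its closure operator $K$ sends $a \subseteq X$ to the intersection of all closed sets containing $a$; equivalently, a closure space is a set $X$ with an operator $K$ on $\mathcal P(X)$ that is inflationary ($a \subseteq Ka$), idempotent ($KKa = Ka$) and isotone ($a \subseteq b$ implies $Ka \subseteq Kb$). Topological spaces, with their closed sets, are special cases. A function $\varphi : X \to Y$ between closure spaces is continuous if $\varphi^{\rightarrow}(K a) \subseteq K\varphi^{\rightarrow}(a)$ for every $a \subseteq X$ (equivalently, preimages of closed sets are closed). If $Y$ is a closure space and $Z \subseteq Y$, then $Z$ is a closure space (a subspace of $Y$) with closed sets $Z \cap C$, $C$ closed in $Y$. A continuous map $\varphi : X \to Y$ is an embedding if $\varphi$ induces a homeomorphism (a bijection continuous in both directions) from $X$ onto the subspace $\varphi^{\rightarrow}(X)$ of $Y$. For a closure space $X$ with closure $K$, $\mathbf S(X) = (\mathcal P(X), \cup, \sqsubseteq)$ and $\mathbf P(X) = (\mathcal P(X), \subseteq, \sqsubseteq)$, where $a \sqsubseteq b$ means $a \subseteq Kb$. A homomorphism of specialization semilattices is a function preserving the binary join operation (here $\cup$) and such that $a \sqsubseteq b$ implies $\psi(a) \sqsubseteq \psi(b)$; it is an embedding if it is injective and moreover $\psi(a) \sqsubseteq \psi(b)$ implies $a \sqsubseteq b$. A homomorphism of specialization posets is an order-preserving function such that $a \sqsubseteq b$ implies $\psi(a) \sqsubseteq \psi(b)$;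 it is an embedding if both the order and $\sqsubseteq$ are also reflected. *)

(* Defs.v *)
From mathcomp Require Import all_boot all_order.
From mathcomp Require Import boolp classical_sets topology_structure.
Set Implicit Arguments.
Unset Strict Implicit.
Unset Printing Implicit Defensive.
Local Open Scope classical_set_scope.

Record closureSpace := ClosureSpace {
  cs_sort :> Type;
  cs_closed : set (set cs_sort);
  cs_closedT : cs_closed setT;
  cs_closed_bigcap : forall F : set (set cs_sort),
    F `<=` cs_closed -> cs_closed (\bigcap_(C in F) C) }.

(* [smallest G a] is the intersection of all the members of [G] containing [a] *)
Definition cl (X : closureSpace) (a : set X) : set X :=
  smallest (@cs_closed X) a.

Definition cs_continuous (X Y : closureSpace) (phi : X -> Y) : Prop :=
  forall a : set X, phi @` cl a `<=` cl (phi @` a).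

Section Subspace.
Variables (Y : closureSpace) (Z : set Y).

(* The carrier is the type of the points of [Z], so that the closed set
   "Z intersected with C" becomes the preimage of C under the inclusion. *)
Definition subspace_closed : set (set (set_type Z)) :=
  [set D | exists2 C, @cs_closed Y C & D = val @^-1` C].

Lemma subspace_closedT : subspace_closed setT.
Proof. by exists setT; [exact: cs_closedT|]. Qed.

Lemma subspace_closed_bigcap (F : set (set (set_type Z))) :
  F `<=` subspace_closed -> subspace_closed (\bigcap_(D in F) D).
Proof.
move=> Fcl.
exists (\bigcap_(C in [set C | cs_closed C /\ F (val @^-1` C)]) C).
  by apply: cs_closed_bigcap => C [].
apply/seteqP; split=> [z Fz C [_ FC]|z Fz D FD]; first exact: (Fz _ FC).
have [C Ccl DE] := Fcl _ FD.
by rewrite DE; apply: Fz; split=> //; rewrite -DE.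
Qed.

Definition subspace : closureSpace :=
  ClosureSpace subspace_closedT subspace_closed_bigcap.

End Subspace.

Definition homeomorphism (X Y : closureSpace) (h : X -> Y) : Prop :=
  exists g : Y -> X,
    [/\ cancel h g, cancel g h, cs_continuous h & cs_continuous g].

Definition corestrict (X Y : closureSpace) (phi : X -> Y) (x : X) :
  subspace (range phi) := exist _ (phi x) (mem_range phi x).

Definition cs_embedding (X Y : closureSpace) (phi : X -> Y) : Prop :=
  cs_continuous phi /\ homeomorphism (corestrict phi).

Section TopologicalSpaces.
Variable T : topologicalType.

Lemma top_closed_bigcap (F : set (set T)) :
  F `<=` closed -> closed (\bigcap_(C in F) C).
Proof. by move=> Fcl; apply: closed_bigI => C /Fcl. Qed.

Definition top_closureSpace : closureSpace :=
  ClosureSpace closedT top_closed_bigcap.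

Lemma top_clE (a : set T) : @cl top_closureSpace a = closure a.
Proof. by rewrite closureE. Qed.

End TopologicalSpaces.

Record specSemilattice (d : Order.disp_t) := SpecSemilattice {
  ssl_sort :> joinSemilatticeType d;
  ssl_spec : ssl_sort -> ssl_sort -> Prop;
  ssl_spec_le : forall a b, (a <= b)%O -> ssl_spec a b;
  ssl_spec_trans : forall a b c,
    ssl_spec a b -> ssl_spec b c -> ssl_spec a c;
  ssl_spec_join : forall a a' b,
    ssl_spec a b -> ssl_spec a' b -> ssl_spec (a `|` a')%O b }.

Record specPoset (d : Order.disp_t) := SpecPoset {
  spo_sort :> porderType d;
  spo_spec : spo_sort -> spo_sort -> Prop;
  spo_spec_le : forall a b, (a <= b)%O -> spo_spec a b;
  spo_spec_trans : forall a b c,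
    spo_spec a b -> spo_spec b c -> spo_spec a c }.

Definition ssl_hom d d' (S : specSemilattice d) (T : specSemilattice d')
    (psi : S -> T) : Prop :=
  (forall a b, psi (a `|` b)%O = (psi a `|` psi b)%O) /\
  (forall a b, ssl_spec a b -> ssl_spec (psi a) (psi b)).

Definition ssl_embedding d d' (S : specSemilattice d) (T : specSemilattice d')
    (psi : S -> T) : Prop :=
  [/\ ssl_hom psi, injective psi &
      forall a b, ssl_spec (psi a) (psi b) -> ssl_spec a b].

Definition spo_hom d d' (P : specPoset d) (Q : specPoset d')
    (psi : P -> Q) : Prop :=
  (forall a b, (a <= b)%O -> (psi a <= psi b)%O) /\
  (forall a b, spo_spec a b -> spo_spec (psi a) (psi b)).

Definition spo_embedding d d' (P : specPoset d) (Q : specPoset d')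
    (psi : P -> Q) : Prop :=
  [/\ spo_hom psi,
      forall a b, (psi a <= psi b)%O -> (a <= b)%O &
      forall a b, spo_spec (psi a) (psi b) -> spo_spec a b].

Section PowerSet.
Variable X : closureSpace.
Implicit Types a b c : set X.

Definition spec_cl a b : Prop := a `<=` cl b.

Lemma spec_cl_le a b : (a <= b)%O -> spec_cl a b.
Proof. by move=> /subsetPset ab x /ab bx C [_]; apply. Qed.

Lemma spec_cl_trans a b c : spec_cl a b -> spec_cl b c -> spec_cl a c.
Proof.
move=> ab bc; apply: subset_trans ab _; apply: smallest_sub => //.
by apply: cs_closed_bigcap => C [].
Qed.

Lemma spec_cl_join a a' b :
  spec_cl a b -> spec_cl a' b -> spec_cl (a `|` a')%O b.
Proof. by move=> ab a'b x [/ab|/a'b]. Qed.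

(* The canonical order on [set X] is inclusion, and its join is the union:
   see [subsetEset] and [joinEset]. *)
Definition specS : specSemilattice set_display :=
  @SpecSemilattice _ (set X) spec_cl spec_cl_le spec_cl_trans spec_cl_join.

Definition specP : specPoset set_display :=
  @SpecPoset _ (set X) spec_cl spec_cl_le spec_cl_trans.

End PowerSet.

Definition image_fun (X Y : closureSpace) (phi : X -> Y) (a : set X) : set Y :=
  phi @` a.

(* Main.v *)
Require Import Defs.
From mathcomp Require Import all_boot all_order.
From mathcomp Require Import boolp classical_sets.

(** The relation [a ⊑ b], that is [a `<=` cl b], carries the same information
    as the closure operator, since [cl b] is the largest [a] with [a ⊑ b].
    Hence continuity, [phi @` cl a `<=` cl (phi @` a)], is exactly preservation
    of [⊑] by direct images ([cs_continuousP]).  Direct images always preserve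
    unions and inclusions, so neither notion of homomorphism asks for more.

    Embeddings are handled by an intermediate characterization
    ([cs_embeddingP]): [phi] is an embedding iff it is continuous, injective,
    and its direct image reflects [⊑].  The reason is that closure in a subspace
    is the trace of the closure in the ambient space ([cl_subspace]), so that
    reflection of [⊑] is precisely continuity of the inverse of [phi] on its
    range.  It remains to see that injectivity of [phi], injectivity of its
    direct image, and reflection of inclusion are the same thing; the direct
    image of a singleton is a singleton, which gives the passage from sets back
    to points. *)

Set Implicit Arguments.
Unset Strict Implicit.
Unset Printing Implicit Defensive.
Local Open Scope classical_set_scope.

(** The image of [cl a ⊑ a] is the continuity condition at [a]; conversely
    [a `<=` cl b] is carried into [phi @` cl b]. *)
Lemma cs_continuousP (X Y : closureSpace) (phi : X -> Y) :
  cs_continuous phi <->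
  (forall a b, spec_cl a b -> spec_cl (phi @` a) (phi @` b)).
Proof.
split=> [phic a b ab|phis a]; last exact: phis.
exact: subset_trans (image_subset phi ab) (phic b).
Qed.

(** The closed sets of [subspace Z] that contain [D] are the traces of the
    closed sets of [Y] that contain the image of [D]. *)
Lemma cl_subspace (Y : closureSpace) (Z : set Y) (D : set (subspace Z)) :
  cl D = val @^-1` cl (val @` D).
Proof.
apply/seteqP; split=> z /= Dz.
- move=> C [Ccl DC]; apply: (Dz (val @^-1` C)); split; first by exists C.
  by move=> t Dt; apply: DC; exists t.
- move=> _ [[C Ccl ->] DC]; apply: Dz; split=> // _ [t Dt <-].
  exact: DC.
Qed.

Lemma val_corestrict (X Y : closureSpace) (phi : X -> Y) (a : set X) :
  val @` (corestrict phi @` a) = phi @` a.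
Proof. by rewrite image_comp. Qed.

Lemma cs_continuous_corestrict (X Y : closureSpace) (phi : X -> Y) :
  cs_continuous phi -> cs_continuous (corestrict phi).
Proof.
move=> phic a _ [x ax <-]; rewrite cl_subspace val_corestrict /=.
by apply: phic; exists x.
Qed.

(** Injectivity is what provides an inverse [g] of the corestriction of [phi],
    and continuity of [g] is reflection of [⊑]: for [D] in the range of [phi],
    a point [z] lies in [cl D] iff [phi @` [set g z] ⊑ phi @` (g @` D)]. *)
Lemma cs_embeddingP (X Y : closureSpace) (phi : X -> Y) :
  cs_embedding phi <->
  [/\ cs_continuous phi, injective phi &
      forall a b, spec_cl (phi @` a) (phi @` b) -> spec_cl a b].
Proof.
split=> [[phic [g [phiK gK _ gc]]]|[phic phiI phis]].
  split=> // [x y xy|a b ab x ax].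
    by apply: (can_inj phiK); apply: val_inj.
  have gphib : g @` (corestrict phi @` b) = b.
    by rewrite image_comp (eq_imagel (f' := id)) ?image_id // => y _; exact: phiK.
  rewrite -gphib; apply: gc; exists (corestrict phi x); last exact: phiK.
  by rewrite cl_subspace val_corestrict; apply: ab; exists x.
split=> //.
have phi_surj (z : subspace (range phi)) : {x | phi x = val z}.
  by apply: cid; have [x _ <-] := set_mem (valP z); exists x.
pose g z := sval (phi_surj z).
have phi_g z : phi (g z) = val z by rewrite /g; case: (phi_surj z).
exists g; split.
- by move=> x; apply: phiI; rewrite phi_g.
- by move=> z; apply: val_inj; rewrite /= phi_g.
- exact: cs_continuous_corestrict.
- move=> D _ [z Dz <-]; apply: (phis [set g z]) => // _ [_ -> <-].
  rewrite image_comp (eq_imagel (f' := val)) => [|t _]; last exact: phi_g.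
  by rewrite phi_g; rewrite cl_subspace in Dz.
Qed.

Lemma set1_inj (T : Type) : injective (@set1 T).
Proof. by move=> x y /seteqP[/(_ x erefl)]. Qed.

Lemma ssl_hom_imageP (X Y : closureSpace) (phi : X -> Y) :
  @ssl_hom _ _ (specS X) (specS Y) (image_fun phi) <-> cs_continuous phi.
Proof.
rewrite cs_continuousP; split=> [[]//|phis]; split=> // a b.
exact: image_setU.
Qed.

Lemma spo_hom_imageP (X Y : closureSpace) (phi : X -> Y) :
  @spo_hom _ _ (specP X) (specP Y) (image_fun phi) <-> cs_continuous phi.
Proof.
rewrite cs_continuousP; split=> [[]//|phis]; split=> // a b.
by move=> /subsetPset ab; apply/subsetPset; exact: image_subset.
Qed.

Lemma inj_image_sub (T U : Type) (f : T -> U) (a b : set T) :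
  injective f -> f @` a `<=` f @` b -> a `<=` b.
Proof.
by move=> fI ab x ax; have [|y bY /fI <-] := ab (f x); first by exists x.
Qed.

Lemma ssl_embedding_imageP (X Y : closureSpace) (phi : X -> Y) :
  @ssl_embedding _ _ (specS X) (specS Y) (image_fun phi) <-> cs_embedding phi.
Proof.
rewrite cs_embeddingP.
split=> -[h phiI phis]; split=> //; try exact/ssl_hom_imageP.
  move=> x y xy.
  have : [set x] = [set y] by apply: phiI; rewrite /image_fun !image_set1 xy.
  exact: set1_inj.
move=> a b ab; apply/seteqP.
by split; apply: (inj_image_sub phiI); rewrite [phi @` a]ab.
Qed.

Lemma spo_embedding_imageP (X Y : closureSpace) (phi : X -> Y) :
  @spo_embedding _ _ (specP X) (specP Y) (image_fun phi) <-> cs_embedding phi.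
Proof.
rewrite cs_embeddingP.
split=> [[h phile phis]|[phic phiI phis]]; split=> //; try exact/spo_hom_imageP.
  move=> x y xy.
  have /subsetPset : ([set x] <= [set y])%O.
    by apply: phile; rewrite /image_fun !image_set1 xy.
  by apply.
move=> a b /subsetPset ab; apply/subsetPset; exact: inj_image_sub ab.
Qed.

Theorem proposition2p4 (X Y : closureSpace) (phi : X -> Y) :
  [<-> cs_continuous phi;
       @ssl_hom _ _ (specS X) (specS Y) (image_fun phi);
       @spo_hom _ _ (specP X) (specP Y) (image_fun phi)]
  /\
  [<-> cs_embedding phi;
       @ssl_embedding _ _ (specS X) (specS Y) (image_fun phi);
       @spo_embedding _ _ (specP X) (specP Y) (image_fun phi)].
Proof.
split; tfae.
- by move/ssl_hom_imageP.
- by move/ssl_hom_imageP/spo_hom_imageP.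
- by move/spo_hom_imageP.
- by move/ssl_embedding_imageP.
- by move/ssl_embedding_imageP/spo_embedding_imageP.
- by move/spo_embedding_imageP.
Qed.
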